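(* If $T$ is a Suslin tree, then $\diamondsuit_T$ holds if and only if $\diamondsuit$ holds.
   Context: A tree is a partial order $(T,<_T)$ in which the set of predecessors of each node is well-ordered; every tree is assumed to have a root, denoted $\emptyset$. For $t\in T$, $t{\downarrow}=\{s\in T\mid s<_T t\}$, $\mathrm{ht}(t)$ is the order type of $t{\downarrow}$, and $T_\alpha$ is the set of nodes of height $\alpha$. The height of $T$ is the least $\alpha$ with $T_\alpha=\emptyset$. An $\omega_1$-tree is a tree of height $\omega_1$ all of whose levels $T_\alpha$ are countable. An antichain is a set of pairwise incomparable nodes; a cofinal branch is a chain meeting every level. A Suslin tree is an $\omega_1$-tree with no cofinal branches and no uncountable antichains. A set $U\subseteq T$ is special if it is a union of at most countably many antichains; otherwise it is nonspecial. For $X\subseteq T$, a map $f:X\to T$ is regressive if $f(t)<_T t$ for all $t\in X\setminus\{\emptyset\}$. For $T$ of height $\omega_1$, $NS^T$ is the ideal of all $B\subseteq T$ for which there is a regressive $f:B\to T$ such that $f^{-1}(\{t\})$ is special for every $t\in T$. For a nonspecial tree $T$ of height $\omega_1$, $\diamondsuit_T$ asserts that there is a sequence $(D_t\mid t\in T)$ with $D_t\subseteq t{\downarrow}$ for all $t\in T$ such that for every $X\subseteq T$, $\{t\in T\mid X\cap t{\downarrow}=D_t\}\notin NS^T$. $\diamondsuit$ is Jensen's principle: there is $(D_\alpha)_{\alpha<\omega_1}$ with $D_\alpha\subseteq\alpha$ such that for every $X\subseteq\omega_1$ the set $\{\alpha<\omega_1\mid X\cap\alpha=D_\alpha\}$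 is stationary. *)

(* Defs.v *)
From HB Require Import structures.
From mathcomp Require Import all_boot all_order.
From mathcomp Require Import all_classical.

Set Implicit Arguments.
Unset Strict Implicit.
Unset Printing Implicit Defensive.

Import Order.TTheory.
Local Open Scope order_scope.
Local Open Scope classical_set_scope.

(** * The first uncountable ordinal *)

(* The libraries have no ordinals.  Fix a well-order of an uncountable type;
   the elements with countably many predecessors form its initial segment of
   order type omega_1 (see omega1_well_order, omega1_uncountable and
   omega1_countable_initial). *)

Definition wo_nat : rel (set nat) :=
  sval (wochoice.well_ordering_principle (set nat)).

Record omega1 := Omega1 {
  omega1_val : set nat;
  omega1_valP : countable [set y | wo_nat y omega1_val] }.

Lemma omega1_val_inj : injective omega1_val.
Proof.
by move=> [x xP] [y yP] /= xy; subst y; rewrite (Prop_irrelevance xP yP).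
Qed.

HB.instance Definition _ := gen_eqMixin omega1.
HB.instance Definition _ := gen_choiceMixin omega1.

Lemma wo_nat_wo : wochoice.well_order wo_nat.
Proof. exact: (svalP (wochoice.well_ordering_principle (set nat))). Qed.

Lemma wo_nat_min (A : set (set nat)) : A !=set0 ->
  exists2 x, A x & forall y, A y -> wo_nat x y.
Proof.
move=> [a Aa].
have [|x [[xA xmin] _]] := @wo_nat_wo (mem A); first by exists a; apply/mem_set.
exists x; first exact/set_mem.
by move=> y /mem_set Ay; apply: xmin.
Qed.

Lemma wo_nat_anti : antisymmetric wo_nat.
Proof.
have wo : wochoice.wo_chain wo_nat predT by apply: wochoice.withinW wo_nat_wo.
by move=> x y; apply: (wochoice.wo_chain_antisymmetric wo).
Qed.

Lemma wo_nat_total : total wo_nat.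
Proof.
move=> x y; have [|z [->|->] zmin] := @wo_nat_min [set x; y].
- by exists x; left.
- by rewrite zmin //; right.
- by rewrite orbC zmin //; left.
Qed.

Lemma wo_nat_refl : reflexive wo_nat.
Proof. by move=> x; have := wo_nat_total x x; rewrite orbb. Qed.

Lemma wo_nat_trans : transitive wo_nat.
Proof.
move=> y x z xy yz.
have [|t tin tmin] := @wo_nat_min [set w | w = x \/ w = y \/ w = z].
  by exists x; left.
have tx : wo_nat t x by apply: tmin; left.
have ty : wo_nat t y by apply: tmin; right; left.
have tz : wo_nat t z by apply: tmin; right; right.
case: tin => [<- //|[ety|etz]].
- by rewrite (wo_nat_anti (x := x) (y := y)) // xy -ety.
- suff -> : x = y by [].
  have zy : z = y by apply: wo_nat_anti; rewrite -{1}etz ty yz.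
  by apply: wo_nat_anti; rewrite xy -zy -etz tx.
Qed.

Definition omega1_le (a b : omega1) := wo_nat (omega1_val a) (omega1_val b).

Lemma omega1_le_refl : reflexive omega1_le.
Proof. by move=> a; apply: wo_nat_refl. Qed.

Lemma omega1_le_anti : antisymmetric omega1_le.
Proof. by move=> a b ab; apply/omega1_val_inj/wo_nat_anti. Qed.

Lemma omega1_le_trans : transitive omega1_le.
Proof. by move=> b a c; apply: wo_nat_trans. Qed.

Lemma omega1_le_total : total omega1_le.
Proof. by move=> a b; apply: wo_nat_total. Qed.

Fact omega1_display : Order.disp_t. Proof. exact: (Order.Disp tt tt). Qed.

HB.instance Definition _ := Order.Le_isPOrder.Build omega1_display omega1
  omega1_le_refl omega1_le_anti omega1_le_trans.
HB.instance Definition _ := Order.POrder_isTotal.Build omega1_display omega1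
  omega1_le_total.

Lemma omega1_well_order : wochoice.well_order (<=%O : rel omega1).
Proof.
move=> A [a aA].
have [|_ [x xA <-] xmin] := @wo_nat_min (omega1_val @` [set` A]).
  by exists (omega1_val a), a.
have minx : wochoice.minimum_of <=%O A x.
  by split=> // b bA; apply: xmin; exists b.
exists x; split=> // y [yA ymin].
by apply/le_anti; rewrite minx.2 //= ymin.
Qed.

Lemma omega1_countable_initial (a : omega1) : countable [set b | b < a].
Proof.
have /countable_injP[f finj] := omega1_valP a.
apply/countable_injP; exists (f \o omega1_val) => b c.
rewrite !inE /= => ba ca fbc; apply: omega1_val_inj.
by apply: finj => //; rewrite inE; [exact: ltW ba | exact: ltW ca].
Qed.

Lemma set_nat_uncountable : ~ countable [set: set nat].
Proof.
move=> /countable_injP[f finj].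
pose D := [set n | exists2 A : set nat, f A = n & ~ A n].
have [DfD|nDfD] := pselect (D (f D)); last by apply: (nDfD); exists D.
case: (DfD) => A fA; suff -> : A = D by [].
by apply: finj => //; rewrite inE.
Qed.

Lemma omega1_uncountable : ~ countable [set: omega1].
Proof.
move=> cW.
pose S := [set x : set nat | countable [set y | wo_nat y x]].
have cS : countable S.
  move: cW => /countable_injP[f finj].
  have valK x : S x -> exists a, omega1_val a = x.
    by move=> Sx; exists (Omega1 Sx).
  have [g gP] : {g : set nat -> omega1 | forall x, S x -> omega1_val (g x) = x}.
    apply: cid; have S0 : exists x, S x.
      have [|x _ xmin] := @wo_nat_min setT; first by exists set0.
      exists x; apply: (@sub_countable _ _ _ [set x]); last exact: countable1.
      by apply: subset_card_le => y yx; apply: wo_nat_anti; rewrite yx xmin.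
    case: S0 => x0 Sx0.
    exists (fun x => if pselect (S x) is left Sx then Omega1 Sx else Omega1 Sx0).
    by move=> x Sx; case: pselect.
  apply/countable_injP; exists (f \o g) => x y; rewrite !inE => Sx Sy /= fxy.
  by rewrite -(gP x Sx) -(gP y Sy); congr omega1_val; apply: finj; rewrite ?inE.
have [Sall|] := pselect (forall x, S x).
  by apply: set_nat_uncountable; apply: sub_countable cS; apply: subset_card_le.
move=> /existsNP nS.
have [x nSx xmin] := wo_nat_min nS.
apply: nSx; apply: (@sub_countable _ _ _ (x |` S)).
  apply: subset_card_le => y /= yx.
  have [Sy|nSy] := pselect (S y); first by right.
  by left; apply: wo_nat_anti; rewrite yx xmin.
rewrite -bigcup2E; apply: bigcup_countable => // -[|[|n]] _ //=.
Qed.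

(** * Jensen's principle *)

Definition club (C : set omega1) :=
  (forall a, exists2 b, C b & a < b) /\
  (forall a, (exists b, b < a) ->
     (forall b, b < a -> exists2 c, C c & b < c < a) -> C a).

Definition stationary (S : set omega1) :=
  forall C, club C -> S `&` C !=set0.

Definition diamond :=
  exists D : omega1 -> set omega1,
    (forall a, D a `<=` [set b | b < a]) /\
    forall X : set omega1,
      stationary [set a | X `&` [set b | b < a] = D a].

(** * Trees *)

Definition order_iso d d' (P : porderType d) (Q : porderType d')
    (A : set P) (B : set Q) :=
  exists2 f : P -> Q, set_bij A B f & {in A &, {mono f : x y / x < y}}.

Section Trees.
Context {d : Order.disp_t}.

(* The root is \bot. *)
Definition tree (T : bPOrderType d) :=
  forall t : T, wochoice.wo_chain <=%O (< t).

Context {T : bPOrderType d}.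
Implicit Types (s t : T) (A B U X : set T) (a : omega1).

Definition preds t : set T := [set s | s < t].

Definition level a : set T := [set t | order_iso (preds t) [set b | b < a]].

(* The second clause says that no node has height omega_1. *)
Definition height_omega1 :=
  (forall a, level a !=set0) /\
  ~ exists t, order_iso (preds t) [set: omega1].

Definition antichain A := forall s t, A s -> A t -> s != t -> s >< t.

Definition cofinal_branch B :=
  total_on B <=%O /\ forall a, B `&` level a !=set0.

Definition special U :=
  exists F : set (set T),
    [/\ countable F, F `<=` antichain & U = \bigcup_(A in F) A].

Definition regressive X (f : T -> T) := forall t, X t -> t != \bot -> f t < t.

Definition NS B :=
  exists2 f : T -> T, regressive B f &
    forall t, special (B `&` f @^-1` [set t]).

End Trees.

Arguments height_omega1 {d} T.

Definition omega1_tree d (T : bPOrderType d) :=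
  [/\ tree T, height_omega1 T & forall a, countable (level a : set T)].

Definition suslin_tree d (T : bPOrderType d) :=
  [/\ omega1_tree T,
      ~ exists B : set T, cofinal_branch B
    & forall A : set T, antichain A -> countable A].

(* Meaningful for nonspecial trees of height omega_1; if T is special, then
   every subset of T is in NS. *)
Definition diamond_tree d (T : bPOrderType d) :=
  exists D : T -> set T,
    (forall t, D t `<=` preds t) /\
    forall X : set T, ~ NS [set t | X `&` preds t = D t].

(* Main.v *)
(* In a Suslin tree the special sets are the countable ones, so a pressing-down
   argument shows that a set of nodes is in the nonstationary ideal iff its set
   of heights is nonstationary in omega_1.  Given a diamond sequence, transport
   it along an injection of the nodes into omega_1, which on a club of levels a
   sends the nodes below level a into a.  Conversely, a tree diamond sequence
   makes countably many guesses on each level, and Kunen's argument extracts a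
   diamond sequence from countably many guesses. *)

Require Import Defs.
From mathcomp Require Import all_boot all_order.
From mathcomp Require Import all_classical.

Set Implicit Arguments.
Unset Strict Implicit.
Unset Printing Implicit Defensive.

Import Order.TTheory.
Local Open Scope order_scope.
Local Open Scope classical_set_scope.

(** * Choice and countable sets *)

Lemma exists_choice (A B : Type) (P : A -> B -> Prop) :
  (forall x, exists y, P x y) -> exists f, forall x, P x (f x).
Proof. by move=> /choice[f fP]; exists f. Qed.

Lemma countable_image (T U : Type) (f : T -> U) (A : set T) :
  countable A -> countable (f @` A).
Proof. exact/sub_countable/card_image_le. Qed.

Lemma countable_subset (T : Type) (A B : set T) :
  A `<=` B -> countable B -> countable A.
Proof. by move=> /subset_card_le/sub_countable. Qed.

Lemma countable_setU (T : Type) (A B : set T) :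
  countable A -> countable B -> countable (A `|` B).
Proof.
by move=> cA cB; rewrite -bigcup2E; apply: bigcup_countable => // -[|[|n]] _ /=.
Qed.

(** * Countable ordinals *)

Lemma omega1_min (A : set omega1) : A !=set0 ->
  exists2 a, A a & forall b, A b -> a <= b.
Proof.
move=> [a Aa]; have [|x [[xA xmin] _]] := @omega1_well_order (mem A).
  by exists a; apply/mem_set.
by exists x => [|b /mem_set]; [exact: set_mem | exact: xmin].
Qed.

Lemma omega1_ind (P : omega1 -> Prop) :
  (forall a, (forall b, b < a -> P b) -> P a) -> forall a, P a.
Proof.
move=> IH a; apply: contrapT => nPa.
have [|m nPm mmin] := @omega1_min [set b | ~ P b]; first by exists a.
apply: nPm; apply: IH => b bm; apply: contrapT => /mmin.
by rewrite leNgt bm.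
Qed.

Lemma omega1_wf : well_founded (fun a b : omega1 => a < b).
Proof. by apply: omega1_ind => a IH; constructor. Qed.

Lemma countable_le_omega1 (a : omega1) : countable [set b | b <= a].
Proof.
apply: (@countable_subset _ _ ([set b | b < a] `|` [set a])).
  by move=> b /=; rewrite le_eqVlt => /orP[/eqP|]; [right | left].
by apply: countable_setU; [exact: omega1_countable_initial | exact: countable1].
Qed.

Lemma countable_ub (A : set omega1) : countable A ->
  exists b, forall a, A a -> a < b.
Proof.
move=> cA; apply: contrapT => /forallNP nub; apply: omega1_uncountable.
apply: (@countable_subset _ _ (\bigcup_(a in A) [set b | b <= a])).
  move=> b _; have /existsNP[a /not_implyP[Aa /negP]] := nub b.
  by rewrite -leNgt => ba; exists a.
by apply: bigcup_countable => // a _; exact: countable_le_omega1.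
Qed.

(** If [h c < c], then [h (h c) < h c], so [h c] is a smaller counterexample. *)
Lemma increasing_ge_id (b : omega1) (h : omega1 -> omega1) :
  (forall x y, x < y -> y < b -> h x < h y) -> forall c, c < b -> c <= h c.
Proof.
move=> hmono; apply: omega1_ind => c IH cb; rewrite leNgt; apply/negP => hc.
by have := IH _ hc (lt_trans hc cb); rewrite leNgt (hmono _ _ hc cb).
Qed.

(** * Closure points *)

(** The values of [R] are sets, so that one [R] can stand for countably many functions. Zero is left
    out because a regressive map is unconstrained at the root. *)
Definition closure_points (R : omega1 -> set omega1) : set omega1 :=
  [set a | (exists b, b < a) /\ forall b, b < a -> R b `<=` [set c | c < a]].

(** Closedness is direct; for unboundedness, iterate from [a] a function [G] that bounds all values
    of [R] up to its argument. *)
Lemma club_closure_points (R : omega1 -> set omega1) :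
  (forall b, countable (R b)) -> club (closure_points R).
Proof.
move=> cR; split=> [a|a a0 lim]; last first.
  split=> // b /lim[c [_ cC] /andP[bc ca]] x Rbx.
  exact: lt_trans (cC _ bc _ Rbx) ca.
have [G GP] : exists G : omega1 -> omega1, forall x,
    x < G x /\ forall y, y <= x -> R y `<=` [set c | c < G x].
  apply: (@exists_choice _ _ (fun x z => x < z /\
      forall y, y <= x -> R y `<=` [set c | c < z])) => x.
  have [|z zP] := @countable_ub ([set x] `|` \bigcup_(y in [set y | y <= x]) R y).
    apply: countable_setU; first exact: countable1.
    by apply: bigcup_countable => //; exact: countable_le_omega1.
  exists z; split=> [|y yx c Ryc]; first by apply: zP; left.
  by apply: zP; right; exists y.
pose s n := iter n G a.
have [|ub ubP] := @countable_ub (range s).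
  by apply: countable_image; exact: countableP.
(* [m] is the supremum of the iterates: any [b < m] is at most some [s n], so [s n.+1] bounds
   [R b]. *)
have [|m mP mmin] := @omega1_min [set b | forall n, s n < b].
  by exists ub => n; apply: ubP; exists n.
exists m; last exact: (mP 0%N).
split=> [|b bm c Rbc]; first by exists a; exact: (mP 0%N).
have [n] : exists n, b <= s n.
  apply: contrapT => /forallNP bs; suff : m <= b by rewrite leNgt bm.
  by apply: mmin => n; rewrite ltNge; apply/negP/bs.
move=> bsn; apply: lt_trans (mP n.+1).
exact: (GP (s n)).2 Rbc.
Qed.

(** Adding to [R b] a point of each [C n] above [b] makes every closure point a limit of every
    [C n]. *)
Lemma club_inter_closure_points (C : nat -> set omega1) (R : omega1 -> set omega1) :
  (forall n, club (C n)) -> (forall b, countable (R b)) ->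
  exists2 E, club E & E `<=` (\bigcap_n C n) `&` closure_points R.
Proof.
move=> Cclub cR.
have [N NP] : exists N : nat * omega1 -> omega1,
    forall p, C p.1 (N p) /\ p.2 < N p.
  apply: (@exists_choice _ _ (fun p c => C p.1 c /\ p.2 < c)) => -[n b].
  by have [c] := (Cclub n).1 b; exists c.
exists (closure_points (fun b => R b `|` range (fun n => N (n, b)))).
  apply: club_closure_points => b; apply: countable_setU => //.
  by apply: countable_image; exact: countableP.
move=> a [a0 aE]; split=> [n _|]; last first.
  by split=> // b ba c Rbc; apply: (aE b ba); left.
apply: (Cclub n).2 => // b ba; have [CN bN] := NP (n, b).
by exists (N (n, b)) => //; rewrite bN; apply: (aE b ba); right; exists n.
Qed.

(** * Injections into [omega1] *)

(** By recursion, [L b] starts an increasing sequence of type omega above all sequences started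
    earlier; [(b, n)] goes to its [n]-th term. *)
Lemma omega1_nat_inj : exists g : omega1 * nat -> omega1, injective g.
Proof.
have [S SP] : exists S : omega1 -> omega1, forall a, a < S a.
  apply: (@exists_choice _ _ (fun a b => a < b)) => a.
  have [b bP] := @countable_ub [set a] (countable1 a).
  by exists b; apply: bP.
(* Total on sets, with a junk value on uncountable ones, so that the recursion need not carry
   countability proofs. *)
have [ub ubP] : exists ub : set omega1 -> omega1,
    forall A, countable A -> forall a, A a -> a < ub A.
  apply: (@exists_choice _ _ (fun A b => countable A -> forall a, A a -> a < b)) => A.
  have [cA|ncA] := pselect (countable A).
    by have [b bP] := countable_ub cA; exists b.
  by have [b _] := countable_ub (@countable0 omega1); exists b.
pose block x : set omega1 := range (fun n => iter n S x).
pose F (b : omega1) (L : forall a : omega1, a < b -> omega1) :=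
  ub [set x | exists a : omega1, exists ab : a < b, block (L a ab) x].
pose L := Fix omega1_wf (fun=> omega1) F.
have LE b : L b = ub (\bigcup_(a in [set a | a < b]) block (L a)).
  rewrite /L Fix_eq -/L; last first.
    move=> x f g fg; congr (F x _).
    by apply: functional_extensionality_dep => y; apply: funext.
  congr ub; apply/seteqP; split=> x.
    by move=> [a [ab xL]]; exists a.
  by move=> [a ab xL]; exists a, ab.
have Llt a b n : a < b -> iter n S (L a) < L b.
  move=> ab; rewrite [L b]LE; apply: ubP; last by exists a => //; exists n.
  apply: bigcup_countable => [|c _]; first exact: omega1_countable_initial.
  by apply: countable_image; exact: countableP.
have le_iter x n : x <= iter n S x.
  by elim: n => //= n IH; apply: le_trans IH (ltW (SP _)).
have iter_mono x n m : (n < m)%N -> iter n S x < iter m S x.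
  by move=> /subnK <-; rewrite iterD; apply: lt_le_trans (SP _) (le_iter _ _).
exists (fun p => iter p.2 S (L p.1)) => -[a n] [b m] /= e.
have disj x y i j : x < y -> iter i S (L x) <> iter j S (L y).
  move=> xy exy; have := lt_le_trans (Llt _ _ i xy) (le_iter (L y) j).
  by rewrite exy ltxx.
case: (ltgtP a b) => [ab|ba|ab].
- by case: (disj _ _ _ _ ab e).
- by case: (disj _ _ _ _ ba (esym e)).
subst b; case: (ltngtP n m) => [nm|mn|-> //].
- by have := iter_mono (L a) _ _ nm; rewrite e ltxx.
- by have := iter_mono (L a) _ _ mn; rewrite e ltxx.
Qed.

(** A point is determined by its value under [r] and its number in an enumeration of that countable
    fibre. *)
Lemma countable_fibers_inj (K : Type) (r : K -> omega1) :
  (forall a, countable (r @^-1` [set a])) ->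
  exists p : K -> omega1, injective p.
Proof.
move=> cr; have [g ginj] := omega1_nat_inj.
have [e eP] : exists e : omega1 -> K -> nat,
    forall a, {in r @^-1` [set a] &, injective (e a)}.
  apply: (@exists_choice _ _ (fun a (e : K -> nat) =>
    {in r @^-1` [set a] &, injective e})) => a.
  by have /countable_injP := cr a.
exists (fun x => g (r x, e (r x) x)) => x y /ginj [rxy exy].
by apply: (eP (r x)); rewrite ?inE //= ?exy ?rxy.
Qed.

(** * Heights *)

Section Height.
Context {d : Order.disp_t} {T : bPOrderType d}.
Implicit Types (s t : T) (a b : omega1).
Hypothesis treeT : tree T.

(** Well-ordering is given only below a node, so a least counterexample is sought among the
    predecessors of a counterexample. *)
Lemma tree_ind (P : T -> Prop) :
  (forall t, (forall s, s < t -> P s) -> P t) -> forall t, P t.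
Proof.
move=> IH t; apply: contrapT => nPt.
have [s st nPs] : exists2 s, s < t & ~ P s.
  apply: contrapT => nex; apply: nPt; apply: IH => s st.
  by apply: contrapT => nPs; apply: nex; exists s.
pose A : {pred T} := [pred s | (s < t) && `[<~ P s>]].
have sA : sub_mem (mem A) (mem (< t)) by move=> x /andP[].
have A0 : wochoice.nonempty A by exists s; apply/andP; split=> //; apply/asboolP.
have [m [[/andP[mt /asboolP nPm] mmin] _]] := treeT sA A0.
apply: nPm; apply: IH => x xm; apply: contrapT => nPx.
have : m <= x by apply: mmin; apply/andP; split; [exact: lt_trans mt | exact/asboolP].
by move=> /(lt_le_trans xm); rewrite ltxx.
Qed.

Lemma preds_comparable x y t : x < t -> y < t -> x >=< y.
Proof.
move=> xt yt; pose A : {pred T} := [pred u | (u == x) || (u == y)].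
have sA : sub_mem (mem A) (mem (< t)) by move=> u /orP[] /eqP ->.
have xA : x \in A by rewrite inE eqxx.
have yA : y \in A by rewrite inE eqxx orbT.
have [m [[mA mmin] _]] := treeT sA (ex_intro _ x xA).
move: mA (mmin _ xA) (mmin _ yA); rewrite inE /Order.comparable.
by case/orP=> /eqP -> => [_ ->|-> _]; rewrite ?orbT.
Qed.

Lemma order_iso_inv t a (f : T -> omega1) :
    set_bij (preds t) [set b | b < a] f ->
    {in preds t &, {mono f : x y / x < y}} ->
  exists g : omega1 -> T, forall b, b < a ->
    [/\ g b < t, f (g b) = b & forall c, c < b -> g c < g b].
Proof.
move=> [fto finj fsurj] fmono.
have [g gP] : exists g : omega1 -> T, forall b, b < a -> g b < t /\ f (g b) = b.
  apply: (@exists_choice _ _ (fun b s => b < a -> s < t /\ f s = b)) => b.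
  have [ba|nba] := pselect (b < a); last by exists \bot.
  by have [s st fs] := fsurj b ba; exists s.
exists g => b ba; have [gbt fgb] := gP _ ba; split=> // c cb.
have [gct fgc] := gP _ (lt_trans cb ba).
by rewrite -fmono ?inE // fgb fgc.
Qed.

(** If [a < b], inverting one isomorphism and applying the other maps [b] increasingly into [a],
    hence sends [a] below itself. *)
Lemma level_le t a b : level a t -> level b t -> b <= a.
Proof.
move=> [f [fto _ _] fmono] [g gbij gmono].
rewrite leNgt; apply/negP => ab.
have [h hP] := order_iso_inv gbij gmono.
have [hat _ _] := hP _ ab.
suff : a <= f (h a) by rewrite leNgt (fto _ hat).
apply: (@increasing_ge_id b (f \o h)) => //= x y xy yb.
have [hy _ hmono] := hP _ yb.
have [hx _ _] := hP _ (lt_trans xy yb).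
by rewrite fmono ?inE //; exact: hmono.
Qed.

Lemma level_uniq t a b : level a t -> level b t -> a = b.
Proof. by move=> ta tb; apply/le_anti; rewrite !(@level_le t). Qed.

(** Below [t], the predecessors of [s] are exactly the nodes that [f] sends below [f s]. *)
Lemma level_restrict s t a (f : T -> omega1) :
    set_bij (preds t) [set b | b < a] f ->
    {in preds t &, {mono f : x y / x < y}} ->
  s < t -> level (f s) s.
Proof.
move=> [fto finj fsurj] fmono st; exists f; last first.
  move=> x y; rewrite !inE => xs ys.
  by apply: fmono; rewrite inE; [exact: lt_trans xs st | exact: lt_trans ys st].
split=> [x xs|x y|b bfs].
- by rewrite /= fmono ?inE //; exact: lt_trans xs st.
- rewrite !inE => xs ys; apply: finj; rewrite inE.
  + exact: lt_trans xs st.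
  + exact: lt_trans ys st.
- have [x xt fx] := fsurj b (lt_trans bfs (fto _ st)).
  by exists x => //; rewrite /preds /= -fmono ?inE // fx.
Qed.

Lemma level_lt s t a b : level a s -> level b t -> s < t -> a < b.
Proof.
move=> sa [f fbij fmono] st.
rewrite (level_uniq sa (level_restrict fbij fmono st)).
by case: fbij => fto _ _; exact: fto.
Qed.

Lemma level_pred t a b : level a t -> b < a -> exists2 s, s < t & level b s.
Proof.
move=> [f fbij fmono] ba; have [_ _ fsurj] := fbij.
have [s st fs] := fsurj b ba; exists s => //.
by rewrite -fs; exact: (level_restrict fbij fmono st).
Qed.

Hypothesis heightT : height_omega1 T.

(** By induction the heights of the predecessors of [t] embed them in [omega1] with downward closed
    range. *)
Lemma exists_level t : exists a, level a t.
Proof.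
elim/tree_ind: t => t IH.
have [z _] := countable_ub (@countable0 omega1).
have [f fP] : exists f : T -> omega1, forall s, s < t -> level (f s) s.
  apply: (@exists_choice _ _ (fun s a => s < t -> level a s)) => s.
  have [st|nst] := pselect (s < t); last by exists z.
  by have [a sa] := IH _ st; exists a.
have fhomo x y : x < y -> y < t -> f x < f y.
  by move=> xy yt; apply: (level_lt _ _ xy); apply: fP => //; exact: lt_trans xy yt.
have fmono : {in preds t &, {mono f : x y / x < y}}.
  move=> x y; rewrite !inE => xt yt; apply/idP/idP => [fxy|xy]; last exact: fhomo.
  case/orP: (preds_comparable xt yt); rewrite le_eqVlt => /orP[/eqP xy|xy] //.
  - by rewrite xy ltxx in fxy.
  - by rewrite xy ltxx in fxy.
  - by have := lt_trans fxy (fhomo _ _ xy xt); rewrite ltxx.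
have finj : {in preds t &, injective f}.
  move=> x y; rewrite !inE => xt yt fxy.
  case/orP: (preds_comparable xt yt); rewrite le_eqVlt => /orP[/eqP xy|xy] //.
  - by have := fhomo _ _ xy yt; rewrite fxy ltxx.
  - by have := fhomo _ _ xy xt; rewrite fxy ltxx.
have fdown s b : s < t -> b < f s -> exists2 x, x < t & f x = b.
  move=> st bfs; have [x xs xb] := level_pred (fP _ st) bfs.
  have xt := lt_trans xs st; exists x => //.
  exact: level_uniq (fP _ xt) xb.
(* The range is all of [omega1], which [heightT] excludes, or the segment below its least missing
   ordinal. *)
have [onto|/existsNP[b0 nb0]] := pselect (forall b, exists2 x, x < t & f x = b).
  have [_ []] := heightT; exists t; exists f => //; split=> // b _.
  by have [x xt fx] := onto b; exists x.
have [|a na amin] := @omega1_min [set b | ~ exists2 x, x < t & f x = b].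
  by exists b0.
exists a, f => //; split=> // [s st|b ba].
  rewrite /= ltNge; apply/negP; rewrite le_eqVlt => /orP[/eqP|/(fdown _ _ st)//].
  by move=> afs; apply: na; exists s.
apply: contrapT => nb; suff : a <= b by rewrite leNgt ba.
by apply: amin => -[x xt fx]; apply: nb; exists x.
Qed.

(** These four facts are the only access to heights from here on. *)
Lemma height_function : exists ht : T -> omega1,
  [/\ forall s t, s < t -> ht s < ht t,
      forall t b, b < ht t -> exists2 s, s < t & ht s = b,
      forall a, exists t, ht t = a
    & forall a, level a = ht @^-1` [set a]].
Proof.
have [ht htP] := exists_choice exists_level.
exists ht; split.
- by move=> s t; exact: (level_lt (htP s) (htP t)).
- move=> t b bt; have [s st sb] := level_pred (htP t) bt.
  by exists s => //; exact: (level_uniq (htP s) sb).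
- by move=> a; have [t ta] := heightT.1 a; exists t; exact: (level_uniq (htP t) ta).
- move=> a; apply/seteqP; split=> t /= => [|<- //].
  exact: (level_uniq (htP t)).
Qed.

End Height.

(** * The nonstationary ideal of a Suslin tree *)

Section Suslin.
Context {d : Order.disp_t} {T : bPOrderType d}.
Implicit Types (s t : T) (a b c : omega1) (B U X : set T).
Hypothesis antichain_countable : forall A : set T, antichain A -> countable A.

Lemma special_countable U : special U <-> countable U.
Proof.
split=> [[F [cF Fanti ->]]|cU].
  by apply: bigcup_countable => // A /Fanti/antichain_countable.
exists ((fun t => [set t]) @` U); split.
- exact: countable_image.
- by move=> _ [t _ <-] x y -> ->; rewrite eqxx.
- apply/seteqP; split=> [t Ut|t [_ [s Us <-] ->] //].
  by exists [set t] => //; exists t.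
Qed.

Context {ht : T -> omega1}.
Hypothesis ht_lt : forall s t, s < t -> ht s < ht t.
Hypothesis ht_pred : forall t b, b < ht t -> exists2 s, s < t & ht s = b.
Hypothesis ht_onto : forall a, exists t, ht t = a.
Hypothesis ht_countable : forall a, countable (ht @^-1` [set a]).

Lemma countable_height_le a : countable [set t | ht t <= a].
Proof.
apply: (@countable_subset _ _ (\bigcup_(b in [set b | b <= a]) ht @^-1` [set b])).
  by move=> t ta; exists (ht t).
by apply: bigcup_countable => //; exact: countable_le_omega1.
Qed.

(** A regressive map with countable fibres cannot exist on nodes of stationarily many heights, by
    closing under heights of fibres. Conversely, if a club [C] misses the heights, each node is
    pressed down into the gap of [C] below it. *)
Lemma NS_height_nonstationary B : NS B <-> ~ stationary (ht @` B).
Proof.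
split=> [[f freg fspec] statB|].
  pose R b := \bigcup_(s in ht @^-1` [set b]) (ht @` (B `&` f @^-1` [set s])).
  have cR b : countable (R b).
    apply: bigcup_countable => // s _; apply: countable_image.
    exact/special_countable/fspec.
  have [_ [[t Bt <-] tC]] := statB _ (club_closure_points cR).
  (* Closure points are nonzero, so [f] is regressive at [t]. *)
  have t0 : t != \bot.
    have [[b bt] _] := tC; have [s st _] := ht_pred bt.
    by apply: contraTneq st => ->; rewrite ltx0.
  suff : ht t < ht t by rewrite ltxx.
  apply: tC.2 (ht_lt (freg _ Bt t0)) _ _.
  by exists (f t) => //; exists t.
move=> /existsNP[C /not_implyP[[Cunb Clim] nBC]].
have [f fP] : exists f : T -> T, forall t, B t -> t != \bot ->
    f t < t /\ forall c, C c -> ht (f t) < c -> ht t <= c.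
  apply: (@exists_choice _ _ (fun t s => B t -> t != \bot ->
    s < t /\ forall c, C c -> ht s < c -> ht t <= c)) => t.
  have [Bt|nBt] := pselect (B t); last by exists t.
  have [->|t0] := eqVneq t \bot; first by exists \bot.
  (* Otherwise [ht t] would be a limit of [C], hence in [C]. *)
  have [b bt bC] : exists2 b, b < ht t & forall c, C c -> b < c -> ht t <= c.
    apply: contrapT => nb; apply: nBC; exists (ht t); split; first by exists t.
    apply: Clim => [|b bt].
      by exists (ht \bot); apply: ht_lt; rewrite lt0x.
    apply: contrapT => nc; apply: nb; exists b => // c Cc bc.
    by rewrite leNgt; apply/negP => ct; apply: nc; exists c => //; rewrite bc.
  by have [s st sb] := ht_pred bt; exists s => _ _; split=> // c; rewrite sb; apply: bC.
exists f => [t Bt t0|s]; first by have [] := fP t Bt t0.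
apply/special_countable; have [c Cc sc] := Cunb (ht s).
apply: countable_subset (countable_height_le c) => t [Bt /= fts].
(* The fibre may contain the root, where [f] is arbitrary. *)
have [->|t0] := eqVneq t \bot.
  apply: le_trans (ltW sc); have [->//|s0] := eqVneq s \bot.
  by apply/ltW/ht_lt; rewrite lt0x.
by have [_] := fP t Bt t0; rewrite fts; apply.
Qed.

(** * Transfer of diamond sequences *)

(** The guess at [t] decodes [D (ht t)] through [p]; it is right at every node of height [a] once
    [p] sends the nodes below level [a] into [a]. *)
Lemma diamond_diamond_tree : diamond -> diamond_tree T.
Proof.
move=> [D [_ Dguess]].
have [p pinj] := countable_fibers_inj ht_countable.
exists (fun t => [set s | s < t /\ D (ht t) (p s)]); split; first by move=> t s [].
move=> X /NS_height_nonstationary; apply => C Cclub.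
have [||E Eclub EC] := @club_inter_closure_points (fun=> C)
  (fun b => p @` (ht @^-1` [set b])) => //.
  by move=> b; exact: countable_image.
have [a [aguess /EC[aC aR]]] := Dguess (p @` X) E Eclub.
have [t ta] := ht_onto a; exists a; split; last exact: (aC 0%N).
exists t => //=; rewrite ta -aguess; apply/seteqP; split=> s [].
  move=> Xs st; split=> //; split; first by exists s.
  by rewrite /=; apply: aR.2 (ht s) _ _ _; [rewrite -ta; exact: ht_lt | exists s].
by move=> st [[s' Xs' /pinj ss'] _]; split=> //; rewrite -ss'.
Qed.

(* If for each [n] the [n]-th guesses on the levels failed at some [X n], coding
   all the [X n] into one set by an injection [g] of [omega1 * nat] would defeat
   all guesses at once. *)
Lemma diamond_tree_diamond : diamond_tree T -> diamond.
Proof.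
move=> [D [Dsub Dguess]].
have [g ginj] := omega1_nat_inj.
(* [u a] lists level [a], possibly with stray values [\bot]. *)
have [u uP] : exists u : omega1 -> nat -> T,
    forall a t, ht t = a -> exists n, u a n = t.
  apply: (@exists_choice _ _ (fun a (u : nat -> T) =>
    forall t, ht t = a -> exists n, u n = t)) => a.
  have /countable_injP[e einj] := ht_countable a.
  have [u uP] : exists u : nat -> T, forall n t, ht t = a -> e t = n -> u n = t.
    apply: (@exists_choice _ _ (fun n s => forall t, ht t = a -> e t = n -> s = t)) => n.
    have [[s sa sn]|nex] := pselect (exists2 s, ht s = a & e s = n).
      by exists s => t ta tn; apply: einj; rewrite ?inE // sn.
    by exists \bot => t ta tn; case: nex; exists t.
  by exists u => t ta; exists (e t); exact: uP.
(* The [n]-th guess at [a] reads the tree guess at [u a n] through heights: height [g (b, n)]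
   encodes membership of [b]. *)
pose G n a := [set b | b < a /\ exists2 s, D (u a n) s & ht s = g (b, n)].
apply: contrapT => ndiam.
have [X XP] : exists X : nat -> set omega1, forall n,
    ~ stationary [set a | X n `&` [set b | b < a] = G n a].
  apply: (@exists_choice _ _ (fun n (X : set omega1) =>
    ~ stationary [set a | X `&` [set b | b < a] = G n a])) => n.
  apply: contrapT => /forallNP nX; apply: ndiam; exists (G n).
  by split=> [a b [] //|Y]; apply: contrapT; exact: (nX Y).
have [C CP] : exists C : nat -> set omega1, forall n, club (C n) /\
    forall a, C n a -> X n `&` [set b | b < a] <> G n a.
  apply: (@exists_choice _ _ (fun n (C : set omega1) => club C /\
    forall a, C a -> X n `&` [set b | b < a] <> G n a)) => n.
  have /existsNP[C /not_implyP[Cclub nC]] := XP n.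
  by exists C; split=> // a Ca Xa; apply: nC; exists a.
have [||E Eclub EC] := @club_inter_closure_points C
  (fun b => range (fun n => g (b, n))).
- by move=> n; have [] := CP n.
- by move=> b; apply: countable_image; exact: countableP.
(* A union of whole levels, so that its trace below any node shows all the [X n] at once. *)
pose Y := [set s | exists n b, X n b /\ ht s = g (b, n)].
apply: (Dguess Y); apply/NS_height_nonstationary => /(_ E Eclub).
move=> [_ [[t tguess <-] /EC[tC tR]]].
have [n un] := uP _ t erefl.
apply: (CP n).2 (ht t) (tC n I) _; apply/seteqP; split=> b.
  move=> [Xb bt]; split=> //; rewrite un -tguess.
  (* Closure under [g] puts the code of [b] below [ht t], so [t] has a predecessor at that
     height. *)
  have gt : g (b, n) < ht t by apply: tR.2 bt _ _; exists n.
  by have [s st sg] := ht_pred gt; exists s => //; split=> //; exists n, b.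
move=> [bt [s]]; rewrite un -tguess => -[[m [c [Xc ->]]] st] /ginj[cb mn].
by split=> //; rewrite -cb -mn.
Qed.

End Suslin.

Theorem corollary4p14 (d : Order.disp_t) (T : bPOrderType d)
  (suslinT : suslin_tree T) : diamond_tree T <-> diamond.
Proof.
have [[treeT heightT levelT] _ antiT] := suslinT.
have [ht [ht_lt ht_pred ht_onto levelE]] := height_function treeT heightT.
have cht a : countable (ht @^-1` [set a]) by rewrite -levelE.
split; first exact: (diamond_tree_diamond antiT ht_lt ht_pred cht).
exact: (diamond_diamond_tree antiT ht_lt ht_pred ht_onto cht).
Qed.
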